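(* In the setting below (Algorithm 2), (i) for every agent $i$ and every strategy $f_i$, $\mathbb E[L_i(\mathrm{id},\dots,\mathrm{id})]\le\mathbb E[L_i(f_i,(\mathrm{id})_{j\ne i})]$; (ii) if there is a feature $k\in[K]$ for which $\Pi$ is not degenerate, then, when all agents are truthful, for every agent $i$, fixed sample sizes $(n_j)_{j\neq i}$ and all $n_i<n_i'$, agent $i$'s expected loss when holding and truthfully submitting $n_i'$ points is strictly smaller than when holding $n_i$ points.
   Context: Setting (Algorithm 2). Fix $m\ge2$ agents and a measurable data space $\mathcal X$. A prior $\Pi$ is a probability distribution on the set of probability distributions on $\mathcal X$. $D\sim\Pi$ is drawn; conditionally on $D$, agent $i$ holds $X_i=(X_{i,1},\dots,X_{i,n_i})$ with entries i.i.d. from $D$, independent across agents (regard $X_{i,1},X_{i,2},\dots$ as an infinite conditionally i.i.d. sequence). A strategy is a measurable map $f:\bigcup_{\ell\ge0}\mathcal X^\ell\to\bigcup_{\ell\ge0}\mathcal X^\ell$; agent $i$ submits $X_i'=f_i(X_i)$; $\mathrm{id}$ is the identity (truthful) strategy. Feature maps $\varphi_1,\dots,\varphi_K:\mathcal X\to\mathbb R$ are measurable. For a finite nonempty multiset $S\subset\mathbb R$, $F_S(t)=\frac1{|S|}\sum_{s\in S}\mathbf 1\{s\le t\}$, and $\varphi_k(S')=\{\varphi_k(x):x\in S'\}$ for $S'\subset\mathcal X$. For $k\in[K]$, $j\ge0$, $r\ge1$ let $h^{(k)}_{j,r}:\mathcal X^j\times\mathbb R\to[0,1]$ be measurable such that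 whenever $D\sim\Pi$ and, conditionally on $D$, $Y_1,\dots,Y_j,T,Z_1,\dots,Z_r$ are i.i.d. from $D$, $h^{(k)}_{j,r}(Y_1,\dots,Y_j,\varphi_k(T))=\mathbb E[F_{\varphi_k(\{Z_1,\dots,Z_r\})}(\varphi_k(T))\mid Y_1,\dots,Y_j,\varphi_k(T)]$ a.s. Mechanism: for each $i$, $X'_{-i}=\bigcup_{j\neq i}X'_j$ (multiset, at least 2 elements), $T_i$ uniformly random from $X'_{-i}$, $Z_i=X'_{-i}\setminus\{T_i\}$, and $L_i=\frac1K\sum_{k=1}^K\big(h^{(k)}_{|X_i'|,|Z_i|}(X_i',\varphi_k(T_i))-F_{\varphi_k(Z_i)}(\varphi_k(T_i))\big)^2$. $L_i(f_1,\dots,f_m)$ is the loss under strategies $f_j$. Expectations are over $D\sim\Pi$, data, and all randomness. Degenerate for feature $k$: with $D\sim\Pi$ and, conditionally on $D$, $X_1,X_2,\dots,T,Z$ i.i.d. from $D$, $\Pi$ is degenerate for feature $k$ if for some $n\in\mathbb N$, $P(\varphi_k(Z)\le\varphi_k(T)\mid\varphi_k(T),X_1,\dots,X_n)=P(\varphi_k(Z)\le\varphi_k(T)\mid\varphi_k(T),X_1,\dots,X_{n+1})$ almost surely. *)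

(* Defs.v *)
From HB Require Import structures.
From mathcomp Require Import all_boot all_order all_algebra.
From mathcomp Require Import all_classical all_reals all_analysis.

Set Implicit Arguments.
Unset Strict Implicit.
Unset Printing Implicit Defensive.

Import Order.TTheory GRing.Theory Num.Theory.

Local Open Scope classical_set_scope.
Local Open Scope ring_scope.

Section PeerPrediction.
Context {R : realType} {d : measure_display} {X : measurableType d}.

Definition empF (S : seq R) (t : R) : R :=
  (count (fun s => s <= t) S)%:R / (size S)%:R.

(* The first m entries of a list, as an m-tuple (padded with a default point;
   only used when size s = m). *)
Definition tuple_of (l : nat) (s : seq X) : l.-tuple X :=
  [tuple nth point s i | i < l].

(* Measurability of a strategy  f : U_l X^l -> U_l X^l  for the disjoint-union
   sigma-algebra: for every input length l and output length k, the set of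
   inputs of length l mapped to outputs of length k is measurable, and on it
   f is a measurable map into X^k. *)
Definition strategy_measurable (f : seq X -> seq X) : Prop :=
  forall l k : nat,
    measurable [set x : l.-tuple X | size (f x) = k] /\
    measurable_fun [set x : l.-tuple X | size (f x) = k]
      (fun x : l.-tuple X => tuple_of k (f x)).

(* Integral of g(Y_1,...,Y_n) with Y_1,...,Y_n i.i.d. from D (iterated
   integral = integral against the product measure D^n for the nonnegative
   measurable integrands used below). *)
Fixpoint int_iid (D : probability X R) (n : nat) :
    (n.-tuple X -> \bar R) -> \bar R :=
  match n return (n.-tuple X -> \bar R) -> \bar R with
  | 0 => fun g => g [tuple]
  | n'.+1 => fun g =>
      (\int[D]_x int_iid D (fun t : n'.-tuple X => g [tuple of x :: t]))%E
  end.

Definition others (m : nat) (xs : 'I_m -> seq X) (i : 'I_m) : seq X :=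
  flatten [seq xs j | j <- enum 'I_m & j != i].

Definition remove_at (p : nat) (s : seq X) : seq X :=
  take p s ++ drop p.+1 s.

(* Loss of agent i given the submissions xs', with the expectation over the
   uniformly random choice of T_i in X'_{-i} taken explicitly
   (T_i = p-th entry of X'_{-i}, Z_i = the remaining entries). *)
Definition loss (m K : nat) (phi : 'I_K -> X -> R)
    (h : 'I_K -> forall j : nat, nat -> j.-tuple X -> R -> R)
    (xs' : 'I_m -> seq X) (i : 'I_m) : R :=
  let O := others xs' i in
  let own := xs' i in
  (size O)%:R^-1 *
  \sum_(p < size O)
    (K%:R^-1 * \sum_(k < K)
       (h k (size own) (size O).-1 (in_tuple own) (phi k (nth point O p))
        - empF (map (phi k) (remove_at p O)) (phi k (nth point O p))) ^+ 2).

Definition block (m : nat) (n : 'I_m -> nat) (j : 'I_m) (s : seq X) : seq X :=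
  take (n j) (drop (\sum_(l < m | (l < j)%N) n l) s).

Definition exp_loss (m K : nat) (Pi : probability (pprobability X R) R)
    (phi : 'I_K -> X -> R)
    (h : 'I_K -> forall j : nat, nat -> j.-tuple X -> R -> R)
    (n : 'I_m -> nat) (fs : 'I_m -> seq X -> seq X) (i : 'I_m) : \bar R :=
  (\int[Pi]_D int_iid (D : probability X R) (n := \sum_(j < m) n j)
      (fun t => (loss phi h (fun j => fs j (block n j t)) i)%:E))%E.

Definition truthful (m : nat) : 'I_m -> seq X -> seq X := fun _ s => s.

Definition deviate (m : nat) (i : 'I_m) (f : seq X -> seq X) :
    'I_m -> seq X -> seq X :=
  fun j => if j == i then f else id.

Definition update_size (m : nat) (n : 'I_m -> nat) (i : 'I_m) (ni : nat) :
    'I_m -> nat :=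
  fun j => if j == i then ni else n j.

(* Standing assumption on h: h k j r (y, phi_k t) is (a version of)
   E[F_{phi_k({Z_1..Z_r})}(phi_k T) | Y_1..Y_j, phi_k T], where
   D ~ Pi and Y, T, Z i.i.d. from D; i.e. h is [0,1]-valued, measurable in
   (Y, phi_k T), and E[h 1_A(Y, phi_k T)] = E[F 1_A(Y, phi_k T)] for all
   measurable A. *)
Definition h_spec (K : nat) (Pi : probability (pprobability X R) R)
    (phi : 'I_K -> X -> R)
    (h : 'I_K -> forall j : nat, nat -> j.-tuple X -> R -> R) : Prop :=
  forall (k : 'I_K) (j r : nat), (0 < r)%N ->
    (forall y t, 0 <= h k j r y t <= 1) /\
    measurable_fun [set: j.-tuple X * R] (fun p => h k j r p.1 p.2) /\
    forall A : set (j.-tuple X * R), measurable A ->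
      (\int[Pi]_D int_iid (D : probability X R) (fun y : j.-tuple X =>
         \int[(D : probability X R)]_tt int_iid (D : probability X R)
           (fun z : r.-tuple X =>
              (empF (map (phi k) z) (phi k tt) * \1_A (y, phi k tt))%:E)))%E
      =
      (\int[Pi]_D int_iid (D : probability X R) (fun y : j.-tuple X =>
         \int[(D : probability X R)]_tt
              (h k j r y (phi k tt) * \1_A (y, phi k tt))%:E))%E.

(* g is a version of P(phi_k Z <= phi_k T | phi_k T, X_1..X_n), where D ~ Pi
   and X_1,...,X_n, T, Z are i.i.d. from D. *)
Definition cond_prob_version (K : nat) (Pi : probability (pprobability X R) R)
    (phi : 'I_K -> X -> R) (k : 'I_K) (n : nat)
    (g : n.-tuple X -> R -> R) : Prop :=
  (forall x t, 0 <= g x t <= 1) /\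
  measurable_fun [set: n.-tuple X * R] (fun p => g p.1 p.2) /\
  forall A : set (n.-tuple X * R), measurable A ->
    (\int[Pi]_D int_iid (D : probability X R) (fun x : n.-tuple X =>
       \int[(D : probability X R)]_tt \int[(D : probability X R)]_z
          (((phi k z <= phi k tt)%R : bool)%:R * \1_A (x, phi k tt))%:E))%E
    =
    (\int[Pi]_D int_iid (D : probability X R) (fun x : n.-tuple X =>
       \int[(D : probability X R)]_tt
          (g x (phi k tt) * \1_A (x, phi k tt))%:E))%E.

Definition degenerate (K : nat) (Pi : probability (pprobability X R) R)
    (phi : 'I_K -> X -> R) (k : 'I_K) : Prop :=
  exists (n : nat) (g1 : n.-tuple X -> R -> R) (g2 : n.+1.-tuple X -> R -> R),
    cond_prob_version Pi phi k g1 /\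
    cond_prob_version Pi phi k g2 /\
    (\int[Pi]_D int_iid (D : probability X R) (fun x : n.-tuple X =>
       \int[(D : probability X R)]_y \int[(D : probability X R)]_tt
          ((g1 x (phi k tt) != g2 [tuple of rcons x y] (phi k tt))%:R)%:E))%E
    = 0%E.

End PeerPrediction.

Arguments truthful {d X} m _ _.

(* Main.v *)
(** Condition on own report Y and on phi_k(T): the loss of a prediction
    u(Y, phi_k(T)) is a squared error against the empirical cdf F, and h is the
    conditional expectation of F given (Y, phi_k(T)).  Exchangeability of the
    i.i.d. sample makes every choice of T contribute equally, and Pythagoras gives
    E(u - F)^2 = E(h - F)^2 + E(u - h)^2.  This yields (i), since any strategy only
    produces another prediction measurable in (Y, phi_k(T)).  For (ii), ignoring
    data is such a prediction, so the loss is nonincreasing in the sample size; if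
    the (n+1)-st point did not help, the predictions from n and n+1 points would
    agree almost surely.  As E[F | ...] = P(phi_k(Z) <= phi_k(T) | ...), this is
    exactly degeneracy. *)
Require Import Defs.
From HB Require Import structures.
From mathcomp Require Import all_boot all_order all_algebra.
From mathcomp Require Import all_classical all_reals all_analysis.
From mathcomp Require Import measurable_realfun ring lra.

Import Order.TTheory GRing.Theory Num.Theory.
Local Open Scope classical_set_scope.
Local Open Scope ring_scope.

(** * Iterated integrals against i.i.d. samples *)

Section IteratedIntegral.
Context {R : realType} {d : measure_display} {X : measurableType d}.
Local Open Scope ereal_scope.

Lemma int_iid_eq (D : probability X R) n (g1 g2 : n.-tuple X -> \bar R) :
  g1 =1 g2 -> int_iid D g1 = int_iid D g2.
Proof. by move=> /funext ->. Qed.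

Lemma int_iid_ge0 (D : probability X R) n (g : n.-tuple X -> \bar R) :
  (forall t, 0 <= g t) -> 0 <= int_iid D g.
Proof.
elim: n g => [|n IH] g g0 /=; first exact: g0.
by apply: integral_ge0 => x _; apply: IH.
Qed.

Lemma int_iid_cst (D : probability X R) n (c : \bar R) :
  int_iid D (fun _ : n.-tuple X => c) = c.
Proof.
elim: n => [//|n IH] /=.
under eq_integral do rewrite IH.
by rewrite integral_cst// [X in c * X](probability_setT D) mule1.
Qed.

(** The induction moves the first sample point into the parameter, turning [T] into [T * X], so the
    parameter space is kept arbitrary. What remains is one integral against the kernel [P]. *)
Lemma measurable_int_iid d' (T : measurableType d') (P : T -> pprobability X R)
    n (g : T * n.-tuple X -> \bar R) :
  measurable_fun [set: T] P -> (forall p, 0 <= g p) ->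
  measurable_fun [set: T * n.-tuple X] g ->
  measurable_fun [set: T]
    (fun t => int_iid (P t : probability X R) (fun y => g (t, y))).
Proof.
elim: n d' T P g => [|n IH] d' T P g mP g0 mg /=.
  apply: measurableT_comp => //; exact: measurable_pair2.
apply: (measurable_fun_integral_sfinite_kernel
  (fun p : T * X => int_iid (P p.1 : probability X R)
     (fun y : n.-tuple X => g (p.1, [tuple of p.2 :: y]))) (kprobability mP)).
  by move=> p; apply: int_iid_ge0.
apply: (IH _ _ (P \o fst)
  (fun q : (T * X) * n.-tuple X => g (q.1.1, [tuple of q.1.2 :: q.2]))) => //.
  exact: measurableT_comp.
apply: measurableT_comp => //; apply/measurable_fun_pairP; split => /=.
  exact: (measurableT_comp measurable_fst measurable_fst).
apply: measurable_cons => //.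
exact: (measurableT_comp measurable_snd measurable_fst).
Qed.

(** Tonelli, applied to one sample coordinate at a time. *)
Lemma int_iid_swap d' (Y : measurableType d') (mu : probability Y R)
    (D : probability X R) n (g : n.-tuple X * Y -> \bar R) :
  (forall p, 0 <= g p) -> measurable_fun [set: n.-tuple X * Y] g ->
  int_iid D (fun t => \int[mu]_y g (t, y)) =
  \int[mu]_y int_iid D (fun t => g (t, y)).
Proof.
elim: n g => [//|n IH] g g0 mg /=.
have mg' : measurable_fun [set: (X * Y) * n.-tuple X]
    (fun q : (X * Y) * n.-tuple X => g ([tuple of q.1.1 :: q.2], q.1.2)).
  apply: measurableT_comp => //; apply/measurable_fun_pairP; split => /=.
    apply: measurable_cons => //.
    exact: (measurableT_comp measurable_fst measurable_fst).
  exact: (measurableT_comp measurable_snd measurable_fst).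
have mh : measurable_fun [set: X * Y] (fun p => int_iid D
    (fun t : n.-tuple X => g ([tuple of p.1 :: t], p.2))).
  apply: (measurable_int_iid _ (X * Y)%type (fun=> (D : pprobability X R)) _
    (fun q => g ([tuple of q.1.1 :: q.2], q.1.2))) => //.
rewrite -[RHS](fubini_tonelli (fun p : X * Y => int_iid D
   (fun t : n.-tuple X => g ([tuple of p.1 :: t], p.2))))//; last first.
  by move=> p; apply: int_iid_ge0.
apply: eq_integral => x _.
apply: (IH (fun p => g ([tuple of x :: p.1], p.2))) => //.
apply: measurableT_comp => //; apply/measurable_fun_pairP; split => //=.
  by apply: measurable_cons.
exact: measurable_snd.
Qed.

End IteratedIntegral.

(** * Integrands on untyped sequences and exchangeability *)

Section SeqIntegral.
Context {R : realType} {d : measure_display} {X : measurableType d}.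
Local Open Scope ereal_scope.

Lemma measurable_nth_tuple n i :
  measurable_fun [set: n.-tuple X] (fun t => nth point t i).
Proof.
have [ni|ni] := leqP n i.
  rewrite (_ : (fun _ => _) = cst point); first exact: measurable_cst.
  by apply/funext => t; rewrite nth_default// size_tuple.
rewrite (_ : (fun _ => _) = fun t => tnth t (Ordinal ni)).
  exact: measurable_tnth.
by apply/funext => t; rewrite (tnth_nth point).
Qed.

(** Here [G] accepts sequences of every length. Once the length of [f t] is constant, the composite
    factors through tuples, where measurability is checked coordinatewise. *)
Lemma measurable_fun_seq_comp d1 d2 (T : measurableType d1)
    (U : measurableType d2) n (f : T -> seq X) (G : seq X -> U) :
  (forall t, size (f t) = n) ->
  (forall i, (i < n)%N -> measurable_fun [set: T] (fun t => nth point (f t) i)) ->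
  measurable_fun [set: n.-tuple X] (fun s => G s) ->
  measurable_fun [set: T] (fun t => G (f t)).
Proof.
move=> sf mf mG.
pose F t : n.-tuple X := Tuple (introT eqP (sf t)).
apply: (@measurableT_comp _ _ _ _ _ _ (fun s : n.-tuple X => G s) _ F) => //.
apply/measurable_fun_tnthP => i.
rewrite (_ : _ \o F = fun t => nth point (f t) i); first exact: mf.
by apply/funext => t /=; rewrite (tnth_nth point).
Qed.

Implicit Types (D : probability X R) (G : seq X -> \bar R).

Lemma int_iid_size D n n' G : n = n' ->
  int_iid D (fun s : n.-tuple X => G s) = int_iid D (fun s : n'.-tuple X => G s).
Proof. by move=> ->. Qed.

Lemma int_iid_cat D a b G :
  int_iid D (fun s : (a + b).-tuple X => G s) =
  int_iid D (fun s : a.-tuple X => int_iid D (fun t : b.-tuple X => G (s ++ t))).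
Proof.
elim: a G => [//|a IH] G /=.
by apply: eq_integral => x _; apply: (IH (fun s => G (x :: s))).
Qed.

Lemma measurable_fun_cat d2 (U : measurableType d2) a b (G : seq X -> U) :
  measurable_fun [set: (a + b).-tuple X] (fun s => G s) ->
  measurable_fun [set: a.-tuple X * b.-tuple X] (fun p => G (p.1 ++ p.2)).
Proof.
apply: measurable_fun_seq_comp => [p|i _]; first by rewrite size_cat !size_tuple.
have [ia|ia] := ltnP i a.
  rewrite (_ : (fun _ => _) = fun p : a.-tuple X * b.-tuple X => nth point p.1 i).
    exact: (measurableT_comp (measurable_nth_tuple a i) measurable_fst).
  by apply/funext => p; rewrite nth_cat size_tuple ia.
rewrite (_ : (fun _ => _) = fun p : a.-tuple X * b.-tuple X => nth point p.2 (i - a)).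
  exact: (measurableT_comp (measurable_nth_tuple b (i - a)) measurable_snd).
by apply/funext => p; rewrite nth_cat size_tuple ltnNge ia.
Qed.

(** Cutting the sample at position [p] exposes the coordinate there, and [int_iid_swap] carries its
    integral outside those of the first [p] points. *)
Lemma int_iid_insert D n p G : (p <= n)%N ->
  (forall s, 0 <= G s) -> measurable_fun [set: n.+1.-tuple X] (fun s => G s) ->
  int_iid D (fun s : n.+1.-tuple X => G s) =
  \int[D]_x int_iid D (fun s : n.-tuple X => G (take p s ++ x :: drop p s)).
Proof.
move=> pn G0; rewrite -(subnKC pn); set q := (n - p)%N => mG.
rewrite (int_iid_size D _ _ G (esym (addnS p q))).
rewrite (int_iid_cat D p q.+1 G) /=.
rewrite (int_iid_swap _ _ D D _ (fun z => int_iid D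
  (fun t : q.-tuple X => G (z.1 ++ z.2 :: t)))).
- apply: eq_integral => x _.
  rewrite (int_iid_cat D p q (fun s => G (take p s ++ x :: drop p s))).
  apply: int_iid_eq => s; apply: int_iid_eq => t.
  by rewrite take_size_cat ?size_tuple// drop_size_cat ?size_tuple.
- by move=> z; apply: int_iid_ge0.
apply: (measurable_int_iid _ (p.-tuple X * X)%type (fun=> (D : pprobability X R))
  _ (fun w => G (w.1.1 ++ w.1.2 :: w.2))) => //.
have mG' : measurable_fun [set: p.-tuple X * q.+1.-tuple X]
    (fun w => G (w.1 ++ w.2)) by apply: measurable_fun_cat; rewrite addnS.
apply: (measurableT_comp (f := fun w : p.-tuple X * q.+1.-tuple X => G (w.1 ++ w.2))
  (g := fun w : (p.-tuple X * X) * q.-tuple X => (w.1.1, [tuple of w.1.2 :: w.2]))) => //.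
apply/measurable_fun_pairP; split => /=.
  exact: (measurableT_comp measurable_fst measurable_fst).
apply: measurable_cons => //.
exact: (measurableT_comp measurable_snd measurable_fst).
Qed.

Lemma measurable_fun_reindex d2 (U : measurableType d2) n k js (G : seq X -> U) :
  size js = k -> measurable_fun [set: k.-tuple X] (fun s => G s) ->
  measurable_fun [set: n.-tuple X] (fun s => G [seq nth point s i | i <- js]).
Proof.
move=> sjs; apply: measurable_fun_seq_comp => [t|i ik]; first by rewrite size_map.
under eq_fun do rewrite (nth_map 0%N) ?sjs//.
exact: measurable_nth_tuple.
Qed.

Lemma nth_insert_unbump (s : seq X) p x j : (p <= size s)%N -> j != p ->
  nth point (take p s ++ x :: drop p s) j = nth point s (unbump p j).
Proof.
move=> ps jp; rewrite nth_cat size_takel//; case: ltngtP jp => // jp _.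
  by rewrite nth_take// /unbump ltnNge (ltnW jp) subn0.
rewrite -[(j - p)%N]prednK ?subn_gt0//= nth_drop /unbump jp subn1; congr nth.
by rewrite -subn1 addnBA ?subn_gt0// subnKC ?subn1// ltnW.
Qed.

(** Exchangeability of the i.i.d. sample, by induction on [n]: the first listed index [p] becomes
    the outermost integral by [int_iid_insert], and the other indices, renumbered by [unbump p] to
    skip it, permute the remaining [n] points. *)
Lemma int_iid_perm D n js G : perm_eq js (iota 0 n) ->
  (forall s, 0 <= G s) -> measurable_fun [set: n.-tuple X] (fun s => G s) ->
  int_iid D (fun s : n.-tuple X => G [seq nth point s i | i <- js]) =
  int_iid D (fun s : n.-tuple X => G s).
Proof.
elim: n js G => [|n IH] js G pjs G0 mG.
  by move: pjs => /perm_size/size0nil ->.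
case: js pjs => [/perm_size//|p js] pjs.
have pn : (p <= n)%N.
  by have := perm_mem pjs p; rewrite mem_head mem_iota add0n ltnS => /esym.
have sjs : size js = n by case: (perm_size pjs); rewrite size_iota.
rewrite (int_iid_insert D n p (fun s => G [seq nth point s i | i <- p :: js]))//; last first.
  by apply: (@measurable_fun_reindex _ _ _ n.+1) => //=; rewrite sjs.
rewrite [RHS]/=; apply: eq_integral => x _.
have /andP[pNjs ujs] : uniq (p :: js) by rewrite (perm_uniq pjs) iota_uniq.
have jsne j : j \in js -> j != p by apply: contraTneq => ->.
have pjs' : perm_eq (map (unbump p) js) (iota 0 n).
  have ujs' : uniq (map (unbump p) js).
    rewrite map_inj_in_uniq// => i j /jsne ip /jsne jp E.
    by rewrite -(@unbumpK p i) ?inE// E unbumpK// inE.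
  apply: uniq_perm; [by []|exact: iota_uniq|].
  (* A duplicate-free list of [n] indices permutes [iota 0 n] as soon as it is contained in it. *)
  suff sub : {subset map (unbump p) js <= iota 0 n}.
    by apply: (uniq_min_size ujs' sub _).2; rewrite size_map size_iota sjs.
  move=> _ /mapP[j jjs ->].
  rewrite mem_iota add0n /=.
  have : j \in iota 0 n.+1 by rewrite -(perm_mem pjs) inE jjs orbT.
  rewrite mem_iota add0n ltnS => /= jn.
  have := jsne j jjs; rewrite /unbump; case: (ltngtP j p) => //= jp _.
    by rewrite subn0; exact: leq_trans jp pn.
  by rewrite subn1 -ltnS prednK//; exact: leq_ltn_trans jp.
rewrite -(IH _ (fun s => G (x :: s)) pjs')//; last first.
  apply: (measurable_fun_seq_comp _ _ (n.-tuple X)) mG => [t|[|i] _].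
  - by rewrite /= size_tuple.
  - exact: measurable_cst.
  - exact: measurable_nth_tuple.
apply: int_iid_eq => s; congr (G _) => /=; congr cons.
  by rewrite nth_cat size_takel ?size_tuple// ltnn subnn.
rewrite -map_comp; apply/eq_in_map => j jjs /=.
by rewrite nth_insert_unbump ?size_tuple// jsne.
Qed.

End SeqIntegral.

(** * The law of the sample under the prior, as a single measure *)

Section Mixture.
Context {R : realType} {d : measure_display} {X : measurableType d}.
Local Open Scope ereal_scope.

(* The parameter space [T] is general because the induction on [n] pairs it with
   the first sample point. *)
Lemma int_iid_kernel n d' (T : measurableType d') (P : T -> pprobability X R) :
  measurable_fun [set: T] P ->
  exists k : R.-sfker T ~> (n.-tuple X),
    forall t (g : n.-tuple X -> \bar R), (forall s, 0 <= g s) ->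
      measurable_fun [set: n.-tuple X] g ->
      \int[k t]_s g s = int_iid (P t : probability X R) g.
Proof.
elim: n d' T P => [|n IH] d' T P mP.
  pose c : T -> 0.-tuple X := cst [tuple].
  have mc : measurable_fun [set: T] c by exact: measurable_cst.
  exists (kdirac mc) => t g g0 mg /=.
  by rewrite integral_dirac//= diracT mul1e.
have mP' : measurable_fun [set: T * X] (P \o fst) by exact: measurableT_comp.
have [k kE] := IH _ (T * X)%type _ mP'.
pose c (p : (T * X) * n.-tuple X) : n.+1.-tuple X := [tuple of p.1.2 :: p.2].
have mc : measurable_fun [set: (T * X) * n.-tuple X] c.
  apply: measurable_cons => //.
  exact: (measurableT_comp measurable_snd measurable_fst).
exists (kprobability mP \; (k \; kdirac mc)) => t g g0 mg /=.
rewrite integral_kcomp//=; apply: eq_integral => x _.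
rewrite integral_kcomp//= -(kE (t, x))//; last first.
  by apply: measurableT_comp => //; exact: measurable_cons.
apply: eq_integral => s _.
by rewrite integral_dirac//= diracT mul1e.
Qed.

(** Additivity, monotone convergence and almost everywhere arguments are available for an integral
    against one measure; this makes them apply to the iterated integral. *)
Lemma mixture_iid_measure (Pi : probability (pprobability X R) R) n :
  exists mu : {measure set (n.-tuple X) -> \bar R},
    forall g : n.-tuple X -> \bar R, (forall s, 0 <= g s) ->
      measurable_fun [set: n.-tuple X] g ->
      \int[mu]_s g s = \int[Pi]_D int_iid (D : probability X R) g.
Proof.
(* A kernel from the one-point space is a measure: [Pi] becomes a constant kernel, composed with the
   kernel that sends [D] to its [n]-fold product. *)
pose PiK : unit -> pprobability (pprobability X R) R := cst Pi.
have mPi : measurable_fun [set: unit] PiK by exact: measurable_cst.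
have [k kE] := int_iid_kernel n _ (unit * pprobability X R)%type snd
  measurable_snd.
exists ((kprobability mPi \; k) tt) => g g0 mg /=.
rewrite integral_kcomp//; apply: eq_integral => D _; exact: kE.
Qed.

End Mixture.

(** * Conditional expectations tested against nonnegative functions *)

Section CondExpExtension.
Local Open Scope ereal_scope.
Import HBNNSimple.

(* With [p] the observed data, [H] acts as the conditional expectation of [F]
   given [p]: testing against indicators suffices. *)
Lemma eq_integral_mul_comp d1 d2 (R : realType) (S : measurableType d1)
    (Y : measurableType d2) (mu : {measure set S -> \bar R}) (p : S -> Y)
    (F H : S -> R) (u : Y -> R) :
  measurable_fun [set: S] p ->
  measurable_fun [set: S] F -> (forall s, 0 <= F s)%R ->
  measurable_fun [set: S] H -> (forall s, 0 <= H s)%R ->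
  measurable_fun [set: Y] u -> (forall y, 0 <= u y)%R ->
  (forall A, measurable A -> \int[mu]_s (F s * \1_A (p s))%:E =
                             \int[mu]_s (H s * \1_A (p s))%:E) ->
  \int[mu]_s (F s * u (p s))%:E = \int[mu]_s (H s * u (p s))%:E.
Proof.
move=> mp mF F0 mH H0 mu' u0 FH.
have mEu : measurable_fun [set: Y] (EFin \o u) by exact/measurable_EFinP.
pose u_ := nnsfun_approx measurableT mEu.
(* Monotone convergence reduces the test function [u] to its simple approximations [u_ n]. *)
have key (G : S -> R) : measurable_fun [set: S] G -> (forall s, 0 <= G s)%R ->
    \int[mu]_s (G s * u (p s))%:E =
    limn (fun n => \int[mu]_s (G s * u_ n (p s))%:E).
  move=> mG G0.
  have mGn n : measurable_fun [set: S] (fun s => (G s * u_ n (p s))%:E).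
    apply/measurable_EFinP; apply: measurable_funM => //.
    exact: (measurableT_comp (measurable_funPT (u_ n)) mp).
  rewrite -(@monotone_convergence _ _ _ mu _ measurableT _ mGn).
  - apply: eq_integral => s _; apply/esym/cvg_lim => //.
    rewrite EFinM; under eq_fun do rewrite EFinM.
    apply: cvgeZl => //.
    by apply: (cvg_nnsfun_approx measurableT mEu) => // y _; rewrite lee_fin.
  - by move=> n s _; rewrite lee_fin mulr_ge0.
  - move=> s _ m n mn; rewrite lee_fin ler_wpM2l//.
    by have /lefP := @nd_nnsfun_approx _ _ _ _ measurableT _ mEu m n mn; apply.
rewrite !key//.
suff -> : (fun n => \int[mu]_s (F s * u_ n (p s))%:E) =
          (fun n => \int[mu]_s (H s * u_ n (p s))%:E) by [].
apply/funext => n.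
(* A simple function is a finite combination of indicators of its level sets, so linearity leaves
   only indicator tests, which the hypothesis covers. *)
have key2 (G : S -> R) : measurable_fun [set: S] G -> (forall s, 0 <= G s)%R ->
    \int[mu]_s (G s * u_ n (p s))%:E =
    \sum_(r \in range (u_ n)) r%:E *
       \int[mu]_s (G s * \1_(u_ n @^-1` [set r]) (p s))%:E.
  move=> mG G0.
  have mI r : measurable_fun [set: S]
      (fun s => (G s * \1_(u_ n @^-1` [set r]) (p s))%:E).
    apply/measurable_EFinP; apply: measurable_funM => //.
    by apply: (measurableT_comp _ mp); exact: measurable_indic.
  have I0 r s : 0 <= (r * \1_(u_ n @^-1` [set r]) (p s))%:E.
    by rewrite EFinM nnfun_muleindic_ge0.
  under eq_integral => s _.
    rewrite fimfunE EFinM -fsumEFin// ge0_mule_fsumr//.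
    under eq_fsbigr do rewrite -EFinM mulrCA EFinM.
    over.
  rewrite ge0_integral_fsum//; last 2 first.
  - by move=> r; exact: measurable_funeM.
  - by move=> r s _; rewrite -EFinM mulrCA EFinM mule_ge0// lee_fin.
  apply: eq_fsbigr => r /set_mem[y _ <-].
  rewrite ge0_integralZl//; last by rewrite lee_fin.
  by move=> s _; rewrite lee_fin mulr_ge0.
by rewrite !key2//; apply: eq_fsbigr => r _; rewrite FH.
Qed.

End CondExpExtension.

(** * Expectations over the prior and the sample *)

Section MixtureIntegral.
Context {R : realType} {d : measure_display} {X : measurableType d}.
Local Open Scope ereal_scope.
Variable Pi : probability (pprobability X R) R.

(** The integrand takes untyped sequences, so that one [G] serves several sample sizes without casts
    between tuple types. *)
Definition mixint n (G : seq X -> \bar R) : \bar R :=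
  \int[Pi]_D int_iid (D : probability X R) (fun s : n.-tuple X => G s).

Lemma mixint_measure n :
  exists2 mu : {measure set (n.-tuple X) -> \bar R}, mu setT = 1 &
    forall G : seq X -> \bar R, (forall s, 0 <= G s) ->
      measurable_fun [set: n.-tuple X] (fun s => G s) ->
      mixint n G = \int[mu]_s G s.
Proof.
have [mu muE] := mixture_iid_measure Pi n.
exists mu => [|G G0 mG]; last by rewrite muE.
rewrite -[LHS]mul1e -integral_cst// muE//=.
under eq_integral do rewrite int_iid_cst.
by rewrite integral_cst// [X in _ * X](probability_setT Pi) mul1e.
Qed.

Lemma mixint_ge0 n G : (forall s, 0 <= G s) -> 0 <= mixint n G.
Proof. by move=> G0; apply: integral_ge0 => D _; exact: int_iid_ge0. Qed.

Lemma mixint_le1 n (g : seq X -> R) : (forall s, 0 <= g s <= 1)%R ->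
  measurable_fun [set: n.-tuple X] (fun s => g s) ->
  mixint n (fun s => (g s)%:E) <= 1.
Proof.
move=> g01 mg; have [mu mu1 ->] := mixint_measure n; last 2 first.
- by move=> s; rewrite lee_fin; case/andP: (g01 s).
- exact/measurable_EFinP.
rewrite -mu1 -[leRHS]mul1e -integral_cst//; apply: ge0_le_integral => //.
- by move=> s _; rewrite lee_fin; case/andP: (g01 s).
- exact/measurable_EFinP.
- by move=> s _; rewrite lee_fin; case/andP: (g01 s).
Qed.

Lemma mixint_fin_num n (g : seq X -> R) : (forall s, 0 <= g s <= 1)%R ->
  measurable_fun [set: n.-tuple X] (fun s => g s) ->
  mixint n (fun s => (g s)%:E) \is a fin_num.
Proof.
move=> g01 mg; rewrite ge0_fin_numE; last first.
  by apply: mixint_ge0 => s; rewrite lee_fin; case/andP: (g01 s).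
by apply: (le_lt_trans (mixint_le1 _ _ g01 mg)); rewrite ltry.
Qed.

Lemma mixint_mean n N (c : R) (g : 'I_N -> seq X -> R) : (0 <= c)%R ->
  (forall i s, 0 <= g i s)%R ->
  (forall i, measurable_fun [set: n.-tuple X] (fun s => g i s)) ->
  mixint n (fun s => (c * \sum_(i < N) g i s)%:E) =
  c%:E * \sum_(i < N) mixint n (fun s => (g i s)%:E).
Proof.
move=> c0 g0 mg; have [mu _ muE] := mixint_measure n.
rewrite muE; last 2 first.
- by move=> s; rewrite lee_fin mulr_ge0// sumr_ge0.
- by apply/measurable_EFinP/measurable_funM => //; exact: measurable_sum.
under eq_integral do rewrite EFinM.
rewrite ge0_integralZl//; last 2 first.
- by apply/measurable_EFinP; exact: measurable_sum.
- by move=> s _; rewrite lee_fin sumr_ge0.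
congr (_ * _); under eq_integral do rewrite -sumEFin.
rewrite ge0_integral_sum//.
- apply: eq_bigr => i _; rewrite muE// => [s|]; first by rewrite lee_fin.
  exact/measurable_EFinP.
- by move=> i; exact/measurable_EFinP.
- by move=> i s _; rewrite lee_fin.
Qed.

Lemma mixint_perm n js (G : seq X -> \bar R) : perm_eq js (iota 0 n) ->
  (forall s, 0 <= G s) -> measurable_fun [set: n.-tuple X] (fun s => G s) ->
  mixint n (fun s => G [seq nth point s i | i <- js]) = mixint n G.
Proof.
by move=> pjs G0 mG; apply: eq_integral => D _; exact: int_iid_perm.
Qed.

End MixtureIntegral.

(** * Conditional expectation as a projection *)

Section Projection.
Local Open Scope ereal_scope.
Context d (S : measurableType d) (R : realType) (mu : {measure set S -> \bar R}).

(** The last two hypotheses make [F - H] orthogonal to both [U] and [H], hence to [U - H], so the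
    cross term of [((U - H) + (H - F)) ^+ 2] integrates to zero. *)
Lemma integral_sqr_pythagoras (U F H : S -> R) : mu setT = 1 ->
  measurable_fun [set: S] U -> (forall s, 0 <= U s <= 1)%R ->
  measurable_fun [set: S] F -> (forall s, 0 <= F s <= 1)%R ->
  measurable_fun [set: S] H -> (forall s, 0 <= H s <= 1)%R ->
  \int[mu]_s (F s * U s)%:E = \int[mu]_s (H s * U s)%:E ->
  \int[mu]_s (F s * H s)%:E = \int[mu]_s (H s * H s)%:E ->
  \int[mu]_s ((U s - F s) ^+ 2)%:E =
  \int[mu]_s ((H s - F s) ^+ 2)%:E + \int[mu]_s ((U s - H s) ^+ 2)%:E.
Proof.
move=> mu1 mU U01 mF F01 mH H01 FU FH.
have U0 s : (0 <= U s)%R by case/andP: (U01 s).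
have F0 s : (0 <= F s)%R by case/andP: (F01 s).
have H0 s : (0 <= H s)%R by case/andP: (H01 s).
(* Cross terms moved to the side where they are nonnegative, so that only
   additivity of nonnegative integrals is needed. *)
pose c s := ((F s * U s) + (H s * H s))%R.
pose c' s := ((H s * U s) + (F s * H s))%R.
have mc : measurable_fun [set: S] c.
  by apply: measurable_funD; apply: measurable_funM.
have mc' : measurable_fun [set: S] c'.
  by apply: measurable_funD; apply: measurable_funM.
have c0 s : (0 <= c s)%R by rewrite addr_ge0 ?mulr_ge0.
have c'0 s : (0 <= c' s)%R by rewrite addr_ge0 ?mulr_ge0.
have intD (f g : S -> R) : measurable_fun [set: S] f -> (forall s, 0 <= f s)%R ->
    measurable_fun [set: S] g -> (forall s, 0 <= g s)%R ->
    \int[mu]_s (f s + g s)%:E = \int[mu]_s (f s)%:E + \int[mu]_s (g s)%:E.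
  move=> mf f0 mg g0; under eq_integral do rewrite EFinD.
  rewrite ge0_integralD//.
  - by move=> s _; rewrite lee_fin.
  - exact/measurable_EFinP.
  - by move=> s _; rewrite lee_fin.
  - exact/measurable_EFinP.
have mM (f g : S -> R) : measurable_fun [set: S] f -> measurable_fun [set: S] g ->
  measurable_fun [set: S] (fun s => f s * g s)%R by exact: measurable_funM.
have mB2 (f g : S -> R) : measurable_fun [set: S] f -> measurable_fun [set: S] g ->
    measurable_fun [set: S] (fun s => (f s - g s) ^+ 2)%R.
  by move=> mf mg; apply: measurable_funX; exact: measurable_funB.
have cc' : \int[mu]_s (c s)%:E = \int[mu]_s (c' s)%:E.
  by rewrite /c /c' !intD// ?FU ?FH//; try exact: mM; move=> s; rewrite mulr_ge0.
(* Each of the two products in [c] is at most 1 and [mu] has mass 1, so the integral is at most 2.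
   Being finite, it can be cancelled at the end. *)
have cfin : \int[mu]_s (c s)%:E \is a fin_num.
  rewrite ge0_fin_numE; last by apply: integral_ge0 => s _; rewrite lee_fin.
  apply: (@le_lt_trans _ _ (\int[mu]_s (cst 2%:E s))).
    apply: ge0_le_integral => //.
    - by move=> s _; rewrite lee_fin.
    - exact/measurable_EFinP.
    - move=> s _; rewrite lee_fin /c.
      case/andP: (U01 s) => _ U1; case/andP: (F01 s) => _ F1.
      case/andP: (H01 s) => _ H1.
      by rewrite (_ : 2%R = 1 + 1)%R// lerD// mulr_ile1.
  by rewrite integral_cst// mu1 mule1 ltry.
have := @erefl _ (\int[mu]_s ((U s - F s) ^+ 2 + (c s + c s))%:E).
(* Both sides expand to [U^2 + F^2 + 2 H^2]. *)
have Ecc s : ((U s - F s) ^+ 2 + (c s + c s) =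
    (H s - F s) ^+ 2 + (U s - H s) ^+ 2 + (c' s + c' s))%R.
  by rewrite /c /c'; ring.
under [X in _ = X -> _]eq_integral do rewrite Ecc.
have m2 (f : S -> R) : measurable_fun [set: S] f ->
  measurable_fun [set: S] (fun s => f s + f s)%R.
  by move=> mf; exact: measurable_funD.
have s2 (f g : S -> R) s : (0 <= (f s - g s) ^+ 2)%R by exact: sqr_ge0.
have p2 (f : S -> R) s : (0 <= f s -> 0 <= f s + f s)%R.
  by move=> ?; exact: addr_ge0.
rewrite intD//; [|exact: mB2|exact: m2|by move=> s; exact: p2].
rewrite (intD (fun s => (H s - F s) ^+ 2 + (U s - H s) ^+ 2)%R
              (fun s => c' s + c' s)%R); last 4 first.
- by apply: measurable_funD; exact: mB2.
- by move=> s; rewrite addr_ge0.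
- exact: m2.
- by move=> s; exact: p2.
rewrite (intD (fun s => (H s - F s) ^+ 2)%R); [|exact: mB2| by []|exact: mB2|by []].
rewrite !(intD c c)// !(intD c' c')// -cc'.
set e := (X in _ + X = _ + X); move=> E.
have efin : e \is a fin_num by rewrite fin_numD cfin.
by rewrite -[LHS](addeK _ efin) E addeK.
Qed.

End Projection.

(** * Prediction losses *)

Section PeerLoss.
Context {R : realType} {d : measure_display} {X : measurableType d}.
Context {K : nat}.
Variables (Pi : probability (pprobability X R) R) (phi : 'I_K -> X -> R).
Hypothesis mphi : forall k, measurable_fun [set: X] (phi k).
Variable h : 'I_K -> forall j : nat, nat -> j.-tuple X -> R -> R.
Hypothesis hE : h_spec Pi phi h.

Lemma empF_itv (S : seq R) t : 0 <= empF S t <= 1.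
Proof.
rewrite /empF divr_ge0 ?ler0n//=.
have [->|S0] := eqVneq (size S) 0%N; first by rewrite invr0 mulr0.
by rewrite ler_pdivrMr ?ltr0n ?lt0n// mul1r ler_nat count_size.
Qed.

Lemma tuple_of_take (a : nat) (s : seq X) :
  (a <= size s)%N -> Defs.tuple_of a s = take a s :> seq X.
Proof.
move=> sa; apply: (@eq_from_nth _ point).
  by rewrite size_tuple size_takel.
move=> i; rewrite size_tuple => ia.
by rewrite -(tnth_nth point _ (Ordinal ia)) tnth_mktuple nth_take.
Qed.

Lemma tuple_of_tuple a (x : a.-tuple X) : Defs.tuple_of a x = x.
Proof.
by apply: val_inj; rewrite /= tuple_of_take ?size_tuple// take_oversize ?size_tuple.
Qed.

Lemma measurable_tuple_of d' (T : measurableType d') a (f : T -> seq X) :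
  (forall i, (i < a)%N -> measurable_fun [set: T] (fun t => nth point (f t) i)) ->
  measurable_fun [set: T] (fun t => Defs.tuple_of a (f t)).
Proof.
move=> mf; apply/measurable_fun_tnthP => i.
rewrite (_ : _ \o _ = fun t => nth point (f t) i); first exact: mf.
by apply/funext => t /=; rewrite tnth_mktuple.
Qed.

Lemma drop_size_cat_cons a (s1 s2 : seq X) x :
  size s1 = a -> drop a.+1 (s1 ++ x :: s2) = s2.
Proof. by move=> <-; rewrite -addn1 addnC -drop_drop drop_size_cat// drop1. Qed.

Definition measurable_prediction a (u : seq X -> R -> R) : Prop :=
  measurable_fun [set: a.-tuple X * R] (fun p => u p.1 p.2).

Lemma measurable_own_peer k n a (b : nat) :
  measurable_fun [set: n.-tuple X]
    (fun s => (Defs.tuple_of a s, phi k (nth point s b))).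
Proof.
apply/measurable_fun_pairP; split.
  by apply: measurable_tuple_of => i _; exact: measurable_nth_tuple.
by apply: (measurableT_comp (mphi k)); exact: measurable_nth_tuple.
Qed.

Lemma measurable_own_prediction k n a (b : nat) (u : seq X -> R -> R) :
  (a <= n)%N -> measurable_prediction a u ->
  measurable_fun [set: n.-tuple X]
    (fun s => u (take a s) (phi k (nth point s b))).
Proof.
move=> an mu.
rewrite (_ : (fun _ => _) = (fun p : a.-tuple X * R => u p.1 p.2) \o
  (fun s : n.-tuple X => (Defs.tuple_of a s, phi k (nth point s b)))).
  by apply: measurableT_comp => //; exact: measurable_own_peer.
by apply/funext => s /=; rewrite tuple_of_take ?size_tuple.
Qed.

(** The empirical cdf is an average of [r] comparison indicators; the indices of Z start at [a.+1]
    because position [a] holds T. *)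
Lemma measurable_peer_empF k a r :
  measurable_fun [set: (a + r.+1).-tuple X]
    (fun s => empF [seq phi k x | x <- drop a.+1 s] (phi k (nth point s a))).
Proof.
rewrite (_ : (fun _ => _) = fun s : (a + r.+1).-tuple X =>
  (\sum_(i < r) (phi k (nth point s (a.+1 + i)) <= phi k (nth point s a))%R%:R) / r%:R).
  apply: measurable_funM; last exact: measurable_cst.
  apply: measurable_sum => i.
  apply: (measurableT_comp (f := fun b : bool => (b : nat)%:R : R)) => //.
  by apply: measurable_fun_ler; apply: (measurableT_comp (mphi k));
    exact: measurable_nth_tuple.
apply/funext => s.
have sz : size (drop a.+1 s) = r.
  by rewrite size_drop size_tuple addnS subSS addKn.
rewrite /empF size_map sz; congr (_ / _).
rewrite count_map -sum1_count big_mkcond/= natr_sum.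
rewrite (big_nth point) sz big_mkord.
by apply: eq_bigr => i _; rewrite nth_drop; case: ifP.
Qed.

(* Samples of size [a + r.+1] are laid out as own data, then T, then Z. *)
Definition peer_err k a (u : seq X -> R -> R) (s : seq X) : R :=
  (u (take a s) (phi k (nth point s a)) -
   empF [seq phi k x | x <- drop a.+1 s] (phi k (nth point s a))) ^+ 2.

(* [h] on untyped sequences, so that own reports of any length are covered. *)
Definition rule k r (s : seq X) (t : R) : R := h k (size s) r (in_tuple s) t.

Lemma rule_tuple k r a (x : a.-tuple X) t : rule k r x t = h k a r x t.
Proof.
case: x => s sa; rewrite /rule /=; move: (sa); rewrite -(eqP sa) => sa'.
by congr (h k _ r _ t); apply: val_inj.
Qed.

Lemma rule_itv k r s t : (0 < r)%N -> 0 <= rule k r s t <= 1.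
Proof. by move=> r0; exact: (hE k (size s) r r0).1. Qed.

Lemma measurable_rule k r a : (0 < r)%N -> measurable_prediction a (rule k r).
Proof.
move=> r0; rewrite /measurable_prediction.
under eq_fun do rewrite rule_tuple.
exact: (hE k a r r0).2.1.
Qed.

(** The length of the report [f s] varies, so the domain is split into the countably many measurable
    pieces [E j] where it equals [j]. On each piece the prediction is [h k j r] composed with a
    measurable map into [j]-tuples. *)
Lemma measurable_rule_strategy k r a f : (0 < r)%N -> strategy_measurable f ->
  measurable_prediction a (fun s => rule k r (f s)).
Proof.
move=> r0 mf; rewrite /measurable_prediction.
pose E j := [set p : a.-tuple X * R | size (f p.1) = j].
have mE j : measurable (E j).
  have := @measurable_fst _ _ (a.-tuple X) R measurableT _ (mf a j).1.
  by rewrite setTI.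
have -> : [set: a.-tuple X * R] = \bigcup_j E j.
  by apply/seteqP; split => // p _; exists (size (f p.1)).
apply/(measurable_fun_bigcup _ mE) => j.
(* Outside the piece, [g] is a constant padded tuple: this makes it measurable everywhere without
   affecting its values on [E j]. *)
pose g (x : a.-tuple X) : j.-tuple X :=
  if size (f x) == j then Defs.tuple_of j (f x) else Defs.tuple_of j [::].
have fE : (fun x : a.-tuple X => size (f x) == j) @^-1` [set true] =
    [set x | size (f x) = j].
  by apply/seteqP; split => x /= /eqP.
have mg : measurable_fun [set: a.-tuple X] g.
  apply: measurable_fun_if => //.
  - by apply: (measurable_fun_bool true); rewrite setTI fE; exact: (mf a j).1.
  - by rewrite setTI fE; exact: (mf a j).2.
apply: (@eq_measurable_fun _ _ _ _ _
  ((fun q : j.-tuple X * R => h k j r q.1 q.2) \o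
   (fun p : a.-tuple X * R => (g p.1, p.2)))).
  move=> p /set_mem/= pj; rewrite -rule_tuple; congr rule.
  by rewrite /g pj eqxx tuple_of_take ?pj// take_oversize ?pj.
apply: measurable_funTS; apply: measurableT_comp; first exact: (hE k j r r0).2.1.
apply: measurable_fun_pair; last exact: measurable_snd.
exact: (measurableT_comp mg measurable_fst).
Qed.

Definition peer_loss k a r (u : seq X -> R -> R) :=
  mixint Pi (a + r.+1) (fun s => (peer_err k a u s)%:E).

(** The excess term of the Pythagorean decomposition. Its integrand ignores Z, but keeping all
    [a + r.+1] points puts it on the same space as [peer_loss]. *)
Definition rule_gap k a r (u : seq X -> R -> R) : \bar R := mixint Pi (a + r.+1)
  (fun s => ((u (take a s) (phi k (nth point s a)) -
              rule k r (take a s) (phi k (nth point s a))) ^+ 2)%:E).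

(** The defining property in [h_spec], transferred from nested integrals over own data, T and Z to
    one sample laid out in that order. *)
Lemma rule_cond_exp k a r (A : set (a.-tuple X * R)) : (0 < r)%N -> measurable A ->
  mixint Pi (a + r.+1) (fun s =>
     (empF [seq phi k x | x <- drop a.+1 s] (phi k (nth point s a)) *
      \1_A (Defs.tuple_of a s, phi k (nth point s a)))%:E) =
  mixint Pi (a + r.+1) (fun s =>
     (rule k r (take a s) (phi k (nth point s a)) *
      \1_A (Defs.tuple_of a s, phi k (nth point s a)))%:E).
Proof.
move=> r0 mA.
have takeE (y : a.-tuple X) z : Defs.tuple_of a (y ++ z) = y.
  by apply: val_inj; rewrite /= tuple_of_take ?size_cat ?size_tuple ?leq_addr//
    take_size_cat ?size_tuple.
have nthE (y : a.-tuple X) x z : nth point (y ++ x :: z) a = x.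
  by rewrite nth_cat size_tuple ltnn subnn.
have dropE (y : a.-tuple X) x z : drop a.+1 (y ++ x :: z) = z.
  by rewrite drop_size_cat_cons ?size_tuple.
transitivity (\int[Pi]_D int_iid (D : probability X R) (fun y : a.-tuple X =>
         \int[(D : probability X R)]_tt int_iid (D : probability X R)
           (fun z : r.-tuple X =>
              (empF (map (phi k) z) (phi k tt) * \1_A (y, phi k tt))%:E)))%E.
  apply: eq_integral => D _.
  rewrite (int_iid_cat D a r.+1 (fun s =>
    (empF [seq phi k x | x <- drop a.+1 s] (phi k (nth point s a)) *
      \1_A (Defs.tuple_of a s, phi k (nth point s a)))%:E)).
  apply: int_iid_eq => y /=; apply: eq_integral => x _.
  by apply: int_iid_eq => z; rewrite takeE nthE dropE.
rewrite (hE k a r r0).2.2//.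
apply: eq_integral => D _.
rewrite (int_iid_cat D a r.+1 (fun s =>
  (rule k r (take a s) (phi k (nth point s a)) *
    \1_A (Defs.tuple_of a s, phi k (nth point s a)))%:E)).
apply: int_iid_eq => y /=; apply: eq_integral => x _.
(* The [h] side of [h_spec] has no Z; an integral of a constant over the [r] missing points restores
   the common sample size. *)
rewrite -[LHS](int_iid_cst D r); apply: int_iid_eq => z.
by rewrite takeE nthE take_size_cat ?size_tuple// rule_tuple.
Qed.

(** Pythagoras for the projection of the empirical cdf onto functions of the own data and [phi k] of
    T, with [rule k r] as the projection. *)
Lemma peer_lossE k a r (u : seq X -> R -> R) : (0 < r)%N ->
  (forall s t, 0 <= u s t <= 1) ->
  measurable_prediction a u ->
  (peer_loss k a r u = peer_loss k a r (rule k r) + rule_gap k a r u)%E.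
Proof.
move=> r0 u01 mu; have [P P1 PE] := mixint_measure Pi (a + r.+1).
pose p (s : (a + r.+1).-tuple X) := (Defs.tuple_of a s, phi k (nth point s a)).
pose F (s : (a + r.+1).-tuple X) :=
  empF [seq phi k x | x <- drop a.+1 s] (phi k (nth point s a)).
pose U (s : (a + r.+1).-tuple X) := u (take a s) (phi k (nth point s a)).
pose H (s : (a + r.+1).-tuple X) := rule k r (take a s) (phi k (nth point s a)).
have mF : measurable_fun setT F by exact: measurable_peer_empF.
have mU : measurable_fun setT U by apply: measurable_own_prediction => //; exact: leq_addr.
have mH : measurable_fun setT H.
  by apply: measurable_own_prediction; [exact: leq_addr|exact: measurable_rule].
have F01 s : 0 <= F s <= 1 by exact: empF_itv.
have U01 s : 0 <= U s <= 1 by exact: u01.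
have H01 s : 0 <= H s <= 1 by exact: rule_itv.
(* Orthogonality against any prediction [v]; it is used twice, for [v = u] and for
   [v = rule k r]. *)
have key (v : seq X -> R -> R) : (forall s t, 0 <= v s t <= 1) ->
    measurable_prediction a v ->
    (\int[P]_s (F s * v (take a s) (phi k (nth point s a)))%:E =
     \int[P]_s (H s * v (take a s) (phi k (nth point s a)))%:E)%E.
  move=> v01 mv.
  have vE (s : (a + r.+1).-tuple X) : v (take a s) (phi k (nth point s a)) =
      (fun q : a.-tuple X * R => v q.1 q.2) (p s).
    by rewrite /= tuple_of_take ?size_tuple ?leq_addr.
  under eq_integral do rewrite vE.
  under [RHS]eq_integral do rewrite vE.
  apply: (eq_integral_mul_comp _ _ _ _ _ P p F H (fun q => v q.1 q.2)) => //.
  - exact: measurable_own_peer.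
  - by move=> s; case/andP: (F01 s).
  - by move=> s; case/andP: (H01 s).
  - by move=> s; case/andP: (v01 s.1 s.2).
  move=> A mA; have := rule_cond_exp k a r A r0 mA.
  have mI : measurable_fun [set: (a + r.+1).-tuple X] (fun s => \1_A (p s) : R).
    apply: (measurableT_comp (f := \1_A : _ -> R)); first exact: measurable_indic.
    exact: measurable_own_peer.
  rewrite !PE//.
  - by move=> s; rewrite lee_fin mulr_ge0//;
      case/andP: (rule_itv k r (take a s) (phi k (nth point s a)) r0).
  - by apply/measurable_EFinP; apply: measurable_funM.
  - by move=> s; rewrite lee_fin mulr_ge0//;
      case/andP: (empF_itv [seq phi k x | x <- drop a.+1 s] (phi k (nth point s a))).
  - by apply/measurable_EFinP; apply: measurable_funM.
have mB2 (f g : (a + r.+1).-tuple X -> R) : measurable_fun setT f -> measurable_fun setT g ->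
    measurable_fun setT (fun s => ((f s - g s) ^+ 2)%:E).
  by move=> mf mg; apply/measurable_EFinP/measurable_funX; exact: measurable_funB.
have := integral_sqr_pythagoras _ _ _ P U F H P1 mU U01 mF F01 mH H01 (key u u01 mu)
  (key _ (fun s t => rule_itv k r s t r0) (measurable_rule k r a r0)).
rewrite /peer_loss /rule_gap !PE//.
all: try (move=> s; by rewrite lee_fin sqr_ge0).
all: exact: mB2.
Qed.

Lemma peer_loss_min k a r (u : seq X -> R -> R) : (0 < r)%N ->
  (forall s t, 0 <= u s t <= 1) ->
  measurable_prediction a u -> (peer_loss k a r (rule k r) <= peer_loss k a r u)%E.
Proof.
move=> r0 u01 mu; rewrite (peer_lossE k a r u)// leeDl//.
by apply: mixint_ge0 => s; rewrite lee_fin sqr_ge0.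
Qed.

(** Own points that the prediction does not read integrate out, so a predictor that uses [a] points
    can be compared at both sample sizes. *)
Lemma peer_loss_take k a b r (u : seq X -> R -> R) : (a <= b)%N ->
  peer_loss k b r (fun s => u (take a s)) = peer_loss k a r u.
Proof.
move=> ab; apply: eq_integral => D _.
(* The expected error given [D] and the own data [y], after integrating out T and Z. *)
pose g (y : seq X) : \bar R := (\int[(D : probability X R)]_x
  int_iid (D : probability X R) (fun z : r.-tuple X =>
    ((u y (phi k x) - empF (map (phi k) z) (phi k x)) ^+ 2)%:E))%E.
have red c : (a <= c)%N -> int_iid (D : probability X R)
    (fun s : (c + r.+1).-tuple X => (peer_err k c (fun s => u (take a s)) s)%:E) =
    int_iid (D : probability X R) (fun s : c.-tuple X => g (take a s)).
  move=> ac.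
  rewrite (int_iid_cat _ c r.+1 (fun s => (peer_err k c (fun s => u (take a s)) s)%:E)).
  apply: int_iid_eq => y /=; apply: eq_integral => x _; apply: int_iid_eq => z.
  rewrite /peer_err take_size_cat ?size_tuple// nth_cat size_tuple ltnn subnn /=.
  by rewrite drop_size_cat_cons ?size_tuple.
rewrite red// -(subnKC ab) (int_iid_cat _ a (b - a) (fun s => g (take a s))).
transitivity (int_iid (D : probability X R)
   (fun s : (a + r.+1).-tuple X => (peer_err k a (fun s => u (take a s)) s)%:E)).
  rewrite red//; apply: int_iid_eq => y.
  rewrite -[RHS](int_iid_cst D (b - a)); apply: int_iid_eq => z.
  by rewrite take_size_cat ?size_tuple// take_oversize ?size_tuple.
by apply: int_iid_eq => s; rewrite /peer_err take_takel.
Qed.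

(** Two numbers in the unit interval differ by at most 1, so the loss is bounded. Finiteness is what
    keeps inequalities strict under addition in the extended reals. *)
Lemma peer_loss_fin_num k a r (u : seq X -> R -> R) : (forall s t, 0 <= u s t <= 1) ->
  measurable_prediction a u -> peer_loss k a r u \is a fin_num.
Proof.
move=> u01 mu; apply: mixint_fin_num => [s|].
  rewrite /peer_err sqr_ge0 -[leRHS](expr1n _ 2) -real_normK ?num_real//=.
  apply: lerXn2r; rewrite ?nnegrE//.
  have /andP[u0 u1] := u01 (take a s) (phi k (nth point s a)).
  have /andP[e0 e1] := empF_itv [seq phi k x | x <- drop a.+1 s] (phi k (nth point s a)).
  by rewrite ler_norml; lra.
apply: measurable_funX; apply: measurable_funB; last exact: measurable_peer_empF.
by apply: measurable_own_prediction => //; exact: leq_addr.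
Qed.

End PeerLoss.

(** * Expected loss as an average of prediction losses, and degeneracy *)

Section LossFormula.
Context {R : realType} {d : measure_display} {X : measurableType d}.

(** The agents' index ranges tile the pooled sample. The induction removes the last agent, on whom
    no earlier offset depends. *)
Lemma flatten_iota_offset m (n : 'I_m -> nat) :
  flatten [seq iota (\sum_(l < m | (l < j)%N) n l)%N (n j) | j : 'I_m <- enum 'I_m] =
  iota 0 (\sum_(l < m) n l)%N.
Proof.
elim: m n => [|m IH] n; first by rewrite enum_ord0 big_ord0.
rewrite enum_ordSr map_rcons flatten_rcons -map_comp big_ord_recr/= iotaD add0n.
congr cat; last first.
  congr iota; rewrite big_mkcond big_ord_recr/= ltnn addn0.
  by apply: eq_bigr => l _; rewrite ltn_ord.
rewrite -IH; congr flatten; apply: eq_map => j /=.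
congr iota; rewrite big_mkcond big_ord_recr/= ltnNge ltnW// addn0.
by rewrite [RHS]big_mkcond.
Qed.

Lemma block_iota m (n : 'I_m -> nat) (j : 'I_m) (s : seq X) :
  size s = (\sum_(l < m) n l)%N ->
  block n j s =
  [seq nth point s q | q <- iota (\sum_(l < m | (l < j)%N) n l) (n j)].
Proof.
move=> sz; rewrite /block map_nth_iota// sz (bigID (fun l : 'I_m => (l < j)%N))/=.
rewrite addKn (bigD1 j) ?ltnn//=; exact: leq_addr.
Qed.

(** Every choice of T amounts to a rearrangement of the pooled sample into the layout own data, T,
    Z; this is the permutation to which exchangeability is applied. *)
Lemma perm_own_pick_others m (n : 'I_m -> nat) (i : 'I_m) p :
  let off (j : 'I_m) := (\sum_(l < m | (l < j)%N) n l)%N in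
  let oth := flatten [seq iota (off j) (n j) | j <- enum 'I_m & j != i] in
  (p < size oth)%N ->
  perm_eq (iota (off i) (n i) ++ nth 0%N oth p :: take p oth ++ drop p.+1 oth)
          (iota 0 (\sum_(l < m) n l)).
Proof.
move=> off oth poth; rewrite -flatten_iota_offset.
have E : perm_eq (enum 'I_m) (i :: [seq j <- enum 'I_m | j != i]).
  have := @perm_to_rem _ i (enum 'I_m) (mem_enum 'I_m i).
  by rewrite rem_filter ?enum_uniq.
rewrite perm_sym (perm_trans (perm_flatten (perm_map _ E)))//= perm_cat2l.
rewrite -/oth -[X in perm_eq X _](cat_take_drop p oth).
by rewrite (drop_nth 0%N poth) -cat1s perm_catCA.
Qed.

Context {K : nat}.
Variables (Pi : probability (pprobability X R) R) (phi : 'I_K -> X -> R).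
Hypothesis mphi : forall k, measurable_fun [set: X] (phi k).
Variable h : 'I_K -> forall j : nat, nat -> j.-tuple X -> R -> R.
Hypothesis hE : h_spec Pi phi h.

Lemma measurable_peer_err k a r (u : seq X -> R -> R) : measurable_prediction a u ->
  measurable_fun [set: (a + r.+1).-tuple X] (fun s => peer_err phi k a u s).
Proof.
move=> mu; apply: measurable_funX; apply: measurable_funB.
  by apply: (measurable_own_prediction phi mphi) => //; exact: leq_addr.
exact: (measurable_peer_empF phi mphi).
Qed.

(** Averaging over T averages [r.+1] terms, each the same function [G] of a permuted pooled sample.
    By exchangeability they have equal expectations, and a single prediction loss per feature
    remains. *)
Lemma exp_lossE m (n : 'I_m -> nat) (fs : 'I_m -> seq X -> seq X) (i : 'I_m) r :
  (0 < r)%N -> (\sum_(j < m | j != i) n j = r.+1)%N ->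
  strategy_measurable (fs i) ->
  (forall j s, j != i -> fs j s = s) ->
  exp_loss Pi phi h n fs i =
  ((K%:R^-1)%:E * \sum_(k < K)
     peer_loss Pi phi k (n i) r (fun s => rule h k r (fs i s)))%E.
Proof.
move=> r0 nr mfs fsid; set f := fs i.
set N := (\sum_(j < m) n j)%N.
have NE : N = (n i + r.+1)%N by rewrite /N (bigD1 i)//= nr.
pose G s := K%:R^-1 * \sum_(k < K) peer_err phi k (n i) (fun s => rule h k r (f s)) s.
have K0 : 0 <= K%:R^-1 :> R by rewrite invr_ge0.
have e0 k s : 0 <= peer_err phi k (n i) (fun s => rule h k r (f s)) s by exact: sqr_ge0.
have G0 s : 0 <= G s by rewrite mulr_ge0// sumr_ge0.
have me k : measurable_fun [set: (n i + r.+1).-tuple X]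
    (fun s => peer_err phi k (n i) (fun s => rule h k r (f s)) s).
  exact: (measurable_peer_err k (n i) r (fun s => rule h k r (f s))
    (measurable_rule_strategy Pi phi h hE k r (n i) f r0 mfs)).
have mG : measurable_fun [set: N.-tuple X] (fun s => G s).
  by rewrite NE; apply: measurable_funM => //; exact: measurable_sum.
rewrite -(mixint_mean Pi (n i + r.+1) K K%:R^-1
  (fun k s => peer_err phi k (n i) (fun s => rule h k r (f s)) s))// -/(G _).
pose off (j : 'I_m) := (\sum_(l < m | (l < j)%N) n l)%N.
pose oth := flatten [seq iota (off j) (n j) | j <- enum 'I_m & j != i].
have soth : size oth = r.+1.
  rewrite /oth size_flatten /shape -map_comp sumnE big_map big_filter big_enum_cond/=.
  by rewrite -nr; apply: eq_bigr => j _; rewrite size_iota.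
(* Indices of the own data, of the [p]-th peer point chosen as T, and of the other peer points. *)
pose js p := iota (off i) (n i) ++ nth 0%N oth p :: take p oth ++ drop p.+1 oth.
pose gg (p : 'I_r.+1) s := G [seq nth point s q | q <- js p].
have pjs (p : 'I_r.+1) : perm_eq (js p) (iota 0 N).
  by apply: perm_own_pick_others; rewrite -/off -/oth soth.
have lossE (t : N.-tuple X) :
    loss phi h (fun j => fs j (block n j t)) i = r.+1%:R^-1 * \sum_(p < r.+1) gg p t.
  have bE j : block n j t = [seq nth point t q | q <- iota (off j) (n j)].
    by apply: block_iota; rewrite size_tuple.
  have OE : others (fun j => fs j (block n j t)) i = [seq nth point t q | q <- oth].
    rewrite /others /oth map_flatten -map_comp; congr flatten.
    by apply/eq_in_map => j; rewrite mem_filter => /andP[ji _]; rewrite fsid//= bE.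
  rewrite /loss OE size_map soth; congr (_ * _); apply: eq_bigr => p _.
  rewrite /gg /G; congr (_ * _); apply: eq_bigr => k _.
  have sb : size [seq nth point t q | q <- iota (off i) (n i)] = n i.
    by rewrite size_map size_iota.
  rewrite /peer_err /rule /js map_cat take_size_cat//= nth_cat sb ltnn subnn/=.
  rewrite drop_size_cat_cons// -bE.
  rewrite (nth_map 0%N) ?soth//. 
  by rewrite [in RHS]map_cat map_take map_drop.
rewrite /exp_loss.
transitivity (mixint Pi N (fun s => (r.+1%:R^-1 * \sum_(p < r.+1) gg p s)%:E)).
  by apply: eq_integral => D _; apply: int_iid_eq => t; rewrite lossE.
rewrite (mixint_mean Pi N r.+1 r.+1%:R^-1 gg)//; last 2 first.
  by move=> p s; exact: G0.
  move=> p; apply: (measurable_fun_reindex _ _ N N) => //.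
  by rewrite (perm_size (pjs p)) size_iota.
rewrite (eq_bigr (fun=> mixint Pi (n i + r.+1) (fun s => (G s)%:E))); last first.
  move=> p _; rewrite (mixint_perm Pi N (js p) (fun s => (G s)%:E))//.
  - by rewrite NE.
  - exact/measurable_EFinP.
(* The mean of [r.+1] equal expectations is moved back inside the integral, where it collapses by
   arithmetic in [R]. *)
rewrite -(mixint_mean Pi (n i + r.+1) r.+1 r.+1%:R^-1 (fun=> G))//; last by rewrite -NE.
congr mixint; apply/funext => s.
by rewrite sumr_const card_ord -[X in _ * X]mulr_natl mulrA mulVf ?mul1r// pnatr_eq0.
Qed.

(* The offset [c] makes the induction on the sample go through. *)
Lemma int_iid_count (D : probability X R) r (psi : X -> R) t c e :
  measurable_fun [set: X] psi -> 0 <= c -> 0 <= e ->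
  (int_iid D (fun z : r.-tuple X =>
     (c + (count (fun s => s <= t) (map psi z))%:R * e)%:E) =
   c%:E + r%:R%:E * \int[D]_x ((psi x <= t)%R%:R * e)%:E)%E.
Proof.
move=> mpsi; elim: r c => [|r IH] c c0 e0 /=.
  by rewrite mul0r addr0 mul0e adde0.
under eq_integral => x _.
  rewrite (int_iid_eq D r _ (fun z : r.-tuple X => (c + (psi x <= t)%R%:R * e +
      (count (fun s => s <= t) (map psi z))%:R * e)%:E)); last first.
    by move=> z /=; rewrite natrD mulrDl addrA.
  rewrite IH//; last by rewrite addr_ge0// mulr_ge0.
  rewrite EFinD -addeA.
  over.
set I := (\int[D]_x _)%E.
have I0 : (0 <= I)%E by apply: integral_ge0 => x _; rewrite lee_fin mulr_ge0.
have mb : measurable_fun [set: X] (fun x => ((psi x <= t)%R%:R * e)%:E).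
  apply/measurable_EFinP; apply: measurable_funM => //.
  apply: (measurableT_comp (f := fun b : bool => (b : nat)%:R : R)) => //.
  exact: measurable_fun_ler.
rewrite ge0_integralD//; last 2 first.
- by move=> x _; rewrite adde_ge0 ?mule_ge0// ?lee_fin ?mulr_ge0.
- exact: emeasurable_funD.
rewrite ge0_integralD//; last 2 first.
- by move=> x _; rewrite lee_fin mulr_ge0.
- by move=> x _; rewrite mule_ge0.
have cstE (b : \bar R) : (\int[D]_x b = b)%E := int_iid_cst D 1 b.
rewrite !cstE -[r.+1]addn1 natrD EFinD ge0_muleDl// mul1e.
by rewrite [(_ + I)%E]addeC.
Qed.

(** All points of Z contribute equally in expectation, so a single comparison replaces the empirical
    cdf. The weight [b] stands for the indicator of an event in the conditioning data. *)
Lemma int_iid_empF (D : probability X R) r (psi : X -> R) t b : (0 < r)%N ->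
  measurable_fun [set: X] psi -> 0 <= b ->
  (int_iid D (fun z : r.-tuple X => (empF (map psi z) t * b)%:E) =
   \int[D]_x ((psi x <= t)%R%:R * b)%:E)%E.
Proof.
move=> r0 mpsi b0; have rV : r%:R * r%:R^-1 = 1 :> R by rewrite mulfV// pnatr_eq0 -lt0n.
(* The counting formula is used with offset 0 and weight [b / r], whose denominator then cancels the
   factor [r]. *)
rewrite (int_iid_eq D r _ (fun z : r.-tuple X =>
  (0 + (count (fun s => s <= t) (map psi z))%:R * (b / r%:R))%:E)); last first.
  by move=> z; rewrite add0r /empF size_map size_tuple mulrAC mulrA.
rewrite int_iid_count ?divr_ge0// add0e -ge0_integralZl//.
- apply: eq_integral => x _; rewrite -EFinM.
  by rewrite mulrCA [b / _]mulrC [r%:R * _]mulrA rV mul1r.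
- apply/measurable_EFinP; apply: measurable_funM => //.
  apply: (measurableT_comp (f := fun b : bool => (b : nat)%:R : R)) => //.
  exact: measurable_fun_ler.
- by move=> x _; rewrite lee_fin mulr_ge0// divr_ge0.
Qed.

(** Given the own data and T, the empirical cdf of Z and a single comparison have the same
    expectation under each [D], hence the same conditional expectation. *)
Lemma cond_prob_version_rule k n r : (0 < r)%N ->
  cond_prob_version Pi phi k (fun (x : n.-tuple X) t => h k n r x t).
Proof.
move=> r0; have [h01 [mh hA]] := hE k n r r0; split=> //; split=> // A mA.
rewrite -hA//; apply: eq_integral => D _; apply: int_iid_eq => x.
by apply: eq_integral => y _; rewrite int_iid_empF.
Qed.

(** A vanishing expected square forces the predictions from [n] and from [n.+1] points to agree
    almost surely. Both are versions of the conditional probability, so they witness degeneracy. *)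
Lemma degenerate_rule_gap k n r : (0 < r)%N ->
  rule_gap Pi phi h k n.+1 r (fun s => rule h k r (take n s)) = 0%E ->
  degenerate Pi phi k.
Proof.
move=> r0 gap0.
exists n, (fun x t => h k n r x t), (fun x t => h k n.+1 r x t).
split; first exact: cond_prob_version_rule.
split; first exact: cond_prob_version_rule.
(* T sits at position [n.+1], after all own points, also for the prediction [u] that reads only [n]
   of them. *)
pose u (s : seq X) := rule h k r (take n s) (phi k (nth point s n.+1)).
pose v (s : seq X) := rule h k r (take n.+1 s) (phi k (nth point s n.+1)).
have [mu _ muE] := mixint_measure Pi (n.+1 + r.+1).
have mu_ : measurable_fun [set: (n.+1 + r.+1).-tuple X] (fun s => u s).
  apply: (measurable_own_prediction phi mphi k _ n n.+1 (rule h k r)).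
    by rewrite addSn ltnW// ltnS leq_addr.
  exact: (measurable_rule Pi phi h hE).
have mv : measurable_fun [set: (n.+1 + r.+1).-tuple X] (fun s => v s).
  apply: (measurable_own_prediction phi mphi k _ n.+1 n.+1 (rule h k r)).
    exact: leq_addr.
  exact: (measurable_rule Pi phi h hE).
have muv : measurable_fun [set: (n.+1 + r.+1).-tuple X] (fun s => ((u s - v s) ^+ 2)%:E).
  by apply/measurable_EFinP/measurable_funX; exact: measurable_funB.
have mne : measurable_fun [set: (n.+1 + r.+1).-tuple X]
    (fun s => ((u s != v s)%R%:R : R)%:E).
  apply/measurable_EFinP.
  apply: (measurableT_comp (f := fun b : bool => (b : nat)%:R : R)) => //.
  apply: measurable_neg; exact: measurable_fun_eqr.
transitivity (mixint Pi (n.+1 + r.+1) (fun s => ((u s != v s)%R%:R : R)%:E)).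
  apply: eq_integral => D _.
  (* The sample is regrouped as [n] points followed by the extra own point, T and Z; the
     disagreement event does not involve Z, which integrates out. *)
  rewrite (int_iid_size D _ _ (fun s => ((u s != v s)%R%:R : R)%:E) (addSnnS n r.+1)).
  rewrite (int_iid_cat D n r.+2 (fun s => ((u s != v s)%R%:R : R)%:E)).
  apply: int_iid_eq => x /=; apply: eq_integral => y _; apply: eq_integral => tt _.
  rewrite -[LHS](int_iid_cst D r); apply: int_iid_eq => z.
  have E1 : take n (x ++ y :: tt :: z) = x by rewrite take_size_cat ?size_tuple.
  have E2 : take n.+1 (x ++ y :: tt :: z) = rcons x y.
    by rewrite -cat_rcons take_size_cat// size_rcons size_tuple.
  have E3 : nth point (x ++ y :: tt :: z) n.+1 = tt.
    by rewrite -cat_rcons nth_cat size_rcons size_tuple ltnn subnn.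
  by rewrite /u /v E1 E2 E3 -!rule_tuple.
have E : (\int[mu]_s `|((u s - v s) ^+ 2)%:E| = 0)%E.
  rewrite -gap0 /rule_gap.
  rewrite (_ : mixint _ _ _ = mixint Pi (n.+1 + r.+1) (fun s => ((u s - v s) ^+ 2)%:E)).
    rewrite muE//; last by move=> s; rewrite lee_fin sqr_ge0.
    by apply: eq_integral => s _; rewrite gee0_abs// lee_fin sqr_ge0.
  by apply: eq_integral => D _; apply: int_iid_eq => s; rewrite take_takel.
rewrite muE//; rewrite (ae_eq_integral (cst 0%E))//; first by rewrite integral0.
have := (ae_eq_integral_abs mu measurableT muv).1 E.
apply: filterS => s /(_ I)/eqP; rewrite eqe sqrf_eq0 subr_eq0 => /eqP -> _.
by rewrite eqxx.
Qed.

End LossFormula.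

(** * Truthful equilibrium and the strict value of additional data *)

Lemma strategy_measurable_id d (X : measurableType d) :
  strategy_measurable (fun s : seq X => s).
Proof.
move=> l k; have [->|lk] := eqVneq l k.
  have -> : [set x : k.-tuple X | size x = k] = setT.
    by apply/seteqP; split => // x _ /=; rewrite size_tuple.
  split=> //; under eq_fun do rewrite tuple_of_tuple.
  exact: measurable_id.
have -> : [set x : l.-tuple X | size x = k] = set0.
  by apply/seteqP; split => // x /= /eqP; rewrite size_tuple (negbTE lk).
by split; [exact: measurable0|exact: measurable_fun_set0].
Qed.

Theorem theorem2 (R : realType) (d : measure_display) (X : measurableType d)
  (m : nat) (Hm : (2 <= m)%N)
  (Pi : probability (pprobability X R) R)
  (K : nat) (HK : (0 < K)%N)
  (phi : 'I_K -> X -> R) (Hphi : forall k, measurable_fun [set: X] (phi k))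
  (h : 'I_K -> forall j : nat, nat -> j.-tuple X -> R -> R)
  (Hh : h_spec Pi phi h) :
  (* (i) truthfulness is a Bayesian Nash equilibrium *)
  (forall (n : 'I_m -> nat) (i : 'I_m) (f : seq X -> seq X),
      (2 <= \sum_(j < m | j != i) n j)%N ->
      strategy_measurable f ->
      (exp_loss Pi phi h n (truthful m) i
         <= exp_loss Pi phi h n (deviate i f) i)%E) /\
  (* (ii) strictly decreasing expected loss in the own sample size *)
  ((exists k : 'I_K, ~ degenerate Pi phi k) ->
   forall (n : 'I_m -> nat) (i : 'I_m) (ni' : nat),
      (2 <= \sum_(j < m | j != i) n j)%N ->
      (n i < ni')%N ->
      (exp_loss Pi phi h (update_size n i ni') (truthful m) i
         < exp_loss Pi phi h n (truthful m) i)%E).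
Proof.
have idm := strategy_measurable_id _ X; split.
(* The peers hold [r.+2] points: one becomes T and the other [r.+1] form Z, which is therefore
   nonempty. *)
- move=> n i f; case nr : (\sum_(j < m | j != i) n j)%N => [|[|r]]// _ mf.
  rewrite (exp_lossE Pi phi Hphi h Hh m n (truthful m) i r.+1)//.
  rewrite (exp_lossE Pi phi Hphi h Hh m n (deviate i f) i r.+1)//; last 2 first.
  + by rewrite /deviate eqxx.
  + by move=> j s /negbTE; rewrite /deviate => ->.
  apply: lee_wpmul2l; first by rewrite lee_fin invr_ge0.
  apply: lee_sum => k _; rewrite /deviate eqxx.
  apply: (peer_loss_min Pi phi Hphi h Hh) => //.
    by move=> s t; exact: (rule_itv Pi phi h Hh).
  exact: (measurable_rule_strategy Pi phi h Hh).
case=> k0 ndeg n i ni'; case nr : (\sum_(j < m | j != i) n j)%N => [|[|r]]// _ nn'.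
have r0 : (0 < r.+1)%N by [].
(* Changing the own sample size leaves the peers' total unchanged, so both losses involve the same
   [r]. *)
have nr' : (\sum_(j < m | j != i) update_size n i ni' j = r.+2)%N.
  by rewrite -nr; apply: eq_bigr => j /negbTE ji; rewrite /update_size ji.
rewrite (exp_lossE Pi phi Hphi h Hh m _ (truthful m) i r.+1 r0 nr')//.
rewrite (exp_lossE Pi phi Hphi h Hh m n (truthful m) i r.+1)//.
rewrite /truthful /update_size eqxx.
have r01 k s t := rule_itv Pi phi h Hh k r.+1 s t r0.
have mr k a := measurable_rule Pi phi h Hh k r.+1 a r0.
have fin k a := peer_loss_fin_num Pi phi Hphi k a r.+1 _ (r01 k) (mr k a).
have mrt k a b : (a <= b)%N ->
    measurable_prediction b (fun s => rule h k r.+1 (take a s)).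
  move=> ab; rewrite /measurable_prediction.
  rewrite (_ : (fun _ => _) = (fun p : a.-tuple X * R => rule h k r.+1 p.1 p.2) \o
    (fun p : b.-tuple X * R => (Defs.tuple_of a p.1, p.2))).
    apply: measurableT_comp; first exact: mr.
    apply: measurable_fun_pair => //.
    apply: measurable_tuple_of => j _.
    exact: (measurableT_comp (measurable_nth_tuple b j) measurable_fst).
  by apply/funext => p /=; rewrite tuple_of_take ?size_tuple.
(* With [b] points, the rule for [a] points applied to the first [a] of them is an admissible
   prediction, and it cannot beat the optimal one. *)
have mono k a b : (a <= b)%N ->
    (peer_loss Pi phi k b r.+1 (rule h k r.+1) <=
     peer_loss Pi phi k a r.+1 (rule h k r.+1))%E.
  move=> ab; rewrite -(peer_loss_take Pi phi k a b r.+1 (rule h k r.+1) ab).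
  by apply: (peer_loss_min Pi phi Hphi h Hh) => //; exact: mrt.
(* By monotonicity it suffices to gain strictly from one additional point. The gain is the gap
   between the two predictions, and a zero gap would make [Pi] degenerate for [k0]. *)
have strict : (peer_loss Pi phi k0 ni' r.+1 (rule h k0 r.+1) <
               peer_loss Pi phi k0 (n i) r.+1 (rule h k0 r.+1))%E.
  apply: (le_lt_trans (mono k0 _ _ nn')).
  rewrite -(peer_loss_take Pi phi k0 _ _ r.+1 (rule h k0 r.+1) (leqnSn (n i))).
  rewrite (peer_lossE Pi phi Hphi h Hh k0 _ _
    (fun s => rule h k0 r.+1 (take (n i) s)))//; last exact: mrt.
  rewrite lteDl// lt_neqAle; apply/andP; split; last first.
    by apply: mixint_ge0 => s; rewrite lee_fin sqr_ge0.
  apply/eqP => /esym gap0; apply: ndeg.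
  exact: (degenerate_rule_gap Pi phi Hphi h Hh k0 (n i) r.+1).
rewrite lte_pmul2l//; last by rewrite lte_fin invr_gt0 ltr0n.
(* Feature [k0] gains strictly and every other feature weakly; the finite sum over the other
   features preserves strictness. *)
rewrite (bigD1 k0)//= [ltRHS](bigD1 k0)//=.
apply: lte_leD => //.
  by apply/sum_fin_numP => k _ _.
by apply: lee_sum => k _; exact: mono (ltnW nn').
Qed.
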